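(* Let $A,B\in\mathbb{R}^{m\times n}$, $c\in\mathbb{R}^m$, and suppose $w^*\in C_1\cap C_2$. Then there exists $\delta>0$ such that for any $w^0\in\mathbb{R}^n\times\mathbb{R}^n$ with $\|w^0-w^*\|<\delta$, any sequence $\{w^k\}_{k=0}^\infty$ satisfying $w^{k+1}\in(P_{C_1}\circ P_{C_2})(w^k)$ for all $k\ge 0$ converges to a point of $C_1\cap C_2$.
   Context: With $T=[\,A+B\;\;\;-A+B\,]\in\mathbb{R}^{m\times 2n}$, $C_1:=\{w\in\mathbb{R}^n\times\mathbb{R}^n: Tw=\sqrt2\,c\}$ and $C_2:=\{w=(u,v)\in\mathbb{R}^n\times\mathbb{R}^n: u\ge 0,\ v\ge 0,\ \langle u,v\rangle=0\}$ (inequalities componentwise). For a set $S$, $P_S(z):=\{s\in S:\|s-z\|\le\|t-z\|\ \forall t\in S\}$ is the (possibly multivalued) Euclidean metric projector, and $(P_{C_1}\circ P_{C_2})(w)=\bigcup_{w'\in P_{C_2}(w)}P_{C_1}(w')$. *)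

(* Defs.v *)
From HB Require Import structures.
From mathcomp Require Import all_boot all_order all_algebra.
From mathcomp Require Import all_classical all_reals all_analysis.

Set Implicit Arguments.
Unset Strict Implicit.
Unset Printing Implicit Defensive.

Import Order.TTheory GRing.Theory Num.Theory.
Import numFieldNormedType.Exports.

Local Open Scope classical_set_scope.
Local Open Scope ring_scope.

Definition dotv (R : realType) (n : nat) (u v : 'cV[R]_n) : R :=
  \sum_(i < n) u i 0 * v i 0.

(* The norm [`|x|] provided by the library on matrices is the sup norm; the
   Euclidean one is needed for the metric projector. *)
Definition enorm (R : realType) (n : nat) (x : 'cV[R]_n) : R :=
  Num.sqrt (dotv x x).

Definition proj (R : realType) (n : nat) (S : set 'cV[R]_n) (z : 'cV[R]_n) :
    set 'cV[R]_n :=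
  [set s | S s /\ forall t, S t -> enorm (s - z) <= enorm (t - z)].

Definition proj_comp (R : realType) (n : nat) (S1 S2 : set 'cV[R]_n)
    (w : 'cV[R]_n) : set 'cV[R]_n :=
  \bigcup_(w' in proj S2 w) proj S1 w'.

(* A pair (u, v) of R^n x R^n is the stacked vector [col_mx u v : 'cV_(n + n)],
   with u = usubmx w and v = dsubmx w. *)
Definition Tmx (R : realType) (m n : nat) (A B : 'M[R]_(m, n)) :
    'M[R]_(m, n + n) :=
  row_mx (A + B) (- A + B).

Definition C1 (R : realType) (m n : nat) (A B : 'M[R]_(m, n)) (c : 'cV[R]_m) :
    set 'cV[R]_(n + n) :=
  [set w | Tmx A B *m w = Num.sqrt 2 *: c].

Definition C2 (R : realType) (n : nat) : set 'cV[R]_(n + n) :=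
  [set w | [/\ forall i, 0 <= usubmx w i 0,
               forall i, 0 <= dsubmx w i 0
             & dotv (usubmx w) (dsubmx w) = 0]].
Arguments C2 {R n}.

(* Main.v *)
Require Import Defs.
From HB Require Import structures.
From mathcomp Require Import all_boot all_order all_algebra.
From mathcomp Require Import all_classical all_reals all_analysis.
From mathcomp Require Import ring lra.

Set Implicit Arguments.
Unset Strict Implicit.
Unset Printing Implicit Defensive.

(** The set [C2] is a finite union of closed convex cones, so near one of its
    points [y] every other point [s] of [C2] can be joined to [y] by a segment
    inside [C2]: a coordinate that is positive at [y] is still positive at [s],
    so [s] and [y] lie on a common cone.  An affine subspace such as [C1] has
    this property everywhere.  Call it [locally_starshaped]; the theorem holds
    for any two closed locally star-shaped sets ([alternating_proj_cvg]).

    When the segment from a projection [s] of [z] to a point [y] of the set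
    stays in the set, the angle at [s] is obtuse, whence
    |s - y|^2 <= |z - y|^2 - |z - s|^2 ([proj_pythagoras]).  A projection does
    not lie farther from [y] than twice the distance from the projected point
    to [y], so the inequality applies to both projections of a step started
    close enough to [y].  Hence for every [y] in the intersection there is a
    ball around [y] from which a step w |-> p |-> x satisfies
    |x - y|^2 <= |w - y|^2 - |w - p|^2 ([alternating_fejer]).

    Used at the given point, this confines the iterates to a ball and makes the
    squared distances decrease by at least |w k - p k|^2, so w k - p k tends to
    0.  By compactness the sequence has a cluster point [l]; it lies in [S1]
    because the iterates do, and in [S2] because the points [p k] do.  Used a
    second time, at [l], the inequality shows that once an iterate enters the
    ball around [l] the distances to [l] never increase again; as iterates come
    arbitrarily close to [l], the whole sequence converges to it. *)

Import Order.TTheory GRing.Theory Num.Theory.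
Import numFieldNormedType.Exports.

Local Open Scope classical_set_scope.
Local Open Scope ring_scope.

(** * Squared Euclidean distance *)

(** Squared, all the estimates on distances become polynomial inequalities. *)
Definition sqdist (R : realType) (n : nat) (x y : 'cV[R]_n) : R :=
  dotv (x - y) (x - y).

Lemma dotv_ge0 (R : realType) (n : nat) (x : 'cV[R]_n) : 0 <= dotv x x.
Proof. by apply: sumr_ge0 => i _; rewrite -expr2 sqr_ge0. Qed.

Lemma sqdist_ge0 (R : realType) (n : nat) (x y : 'cV[R]_n) : 0 <= sqdist x y.
Proof. exact: dotv_ge0. Qed.

Lemma sqdistC (R : realType) (n : nat) (x y : 'cV[R]_n) :
  sqdist x y = sqdist y x.
Proof. by apply: eq_bigr => i _; rewrite !mxE; ring. Qed.

Lemma sqr_coord_le_sqdist (R : realType) (n : nat) (x y : 'cV[R]_n) (i : 'I_n) :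
  (x i 0 - y i 0) ^+ 2 <= sqdist x y.
Proof.
rewrite /sqdist /dotv (bigD1 i)//= !mxE -expr2 lerDl.
by apply: sumr_ge0 => j _; rewrite -expr2 sqr_ge0.
Qed.

Lemma coord_dist_lt (R : realType) (n : nat) (x y : 'cV[R]_n) (r : R) i :
  0 < r -> sqdist x y < r ^+ 2 -> `|x i 0 - y i 0| < r.
Proof.
move=> r0 /(le_lt_trans (sqr_coord_le_sqdist x y i)).
by rewrite -real_normK ?num_real// ltr_pXn2r// ?nnegrE ?ltW.
Qed.

(** The defect is |x + z - 2 y|^2 (parallelogram law); this stands in for the
    triangle inequality. *)
Lemma sqdist_midpoint (R : realType) (n : nat) (x y z : 'cV[R]_n) :
  sqdist x z <= 2 * sqdist x y + 2 * sqdist y z.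
Proof.
rewrite /sqdist /dotv !mulr_sumr -big_split ler_sum//= => i _.
by rewrite !mxE; have := sqr_ge0 (x i 0 + z i 0 - 2 * y i 0); nra.
Qed.

(** * Projections and segments *)

Lemma enorm_le_sqdist (R : realType) (n : nat) (s t z : 'cV[R]_n) :
  enorm (s - z) <= enorm (t - z) -> sqdist s z <= sqdist t z.
Proof. by rewrite /enorm ler_sqrt// dotv_ge0. Qed.

Lemma proj_le (R : realType) (n : nat) (S : set 'cV[R]_n) (z s t : 'cV[R]_n) :
  Defs.proj S z s -> S t -> sqdist s z <= sqdist t z.
Proof. by case=> _ min_s /min_s /enorm_le_sqdist. Qed.

Lemma sqdist_along (R : realType) (n : nat) (s y z : 'cV[R]_n) (t : R) :
  sqdist (s + t *: (y - s)) z =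
  sqdist s z + 2 * t * dotv (s - z) (y - s) + t ^+ 2 * sqdist s y.
Proof.
rewrite /sqdist /dotv !mulr_sumr -!big_split; apply: eq_bigr => i _ /=.
by rewrite !mxE; ring.
Qed.

(** Moving from [s] towards [y] cannot bring one closer to [z], so the squared
    distance to [z] has a nonnegative slope [2 * b] at [s]: the angle at [s] in
    the triangle [z], [s], [y] is at least right. *)
Lemma proj_pythagoras (R : realType) (n : nat) (S : set 'cV[R]_n)
    (z s y : 'cV[R]_n) :
  Defs.proj S z s -> (forall t, 0 <= t <= 1 -> S (s + t *: (y - s))) ->
  sqdist s y <= sqdist z y - sqdist z s.
Proof.
move=> zs seg.
set b := dotv (s - z) (y - s).
have slope t : 0 <= t <= 1 -> 0 <= 2 * t * b + t ^+ 2 * sqdist s y.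
  move=> /seg /(proj_le zs); rewrite sqdist_along -/b; lra.
have b0 : 0 <= b.
  rewrite leNgt; apply/negP => b_lt0.
  have N_ge : - (2 * b) <= sqdist s y.
    by have := slope 1; rewrite lexx ler01 => /(_ isT); lra.
  have N_gt0 : 0 < sqdist s y by lra.
  (* [- b / sqdist s y] minimises the quadratic in [slope] *)
  have /slope : 0 <= - b / sqdist s y <= 1.
    by rewrite divr_ge0 ?ler_pdivrMr//=; lra.
  have -> : 2 * (- b / sqdist s y) * b + (- b / sqdist s y) ^+ 2 * sqdist s y
          = - (b ^+ 2 / sqdist s y) by field; rewrite gt_eqF.
  by rewrite oppr_ge0 leNgt divr_gt0// exprn_even_gt0//= lt_eqF.
have := sqdist_along s y z 1.
by rewrite scale1r subrKC -/b (sqdistC z y) (sqdistC z s); lra.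
Qed.

(** The radius bounds the squared distance, and may depend on the centre [y]. *)
Definition locally_starshaped (R : realType) (n : nat) (S : set 'cV[R]_n) :=
  forall y, S y -> exists2 r : R, 0 < r &
    forall s, S s -> sqdist s y < r ->
    forall t, 0 <= t <= 1 -> S (s + t *: (y - s)).

(** The factor 4 in the radius: [s] is at most as far from [z] as [y] is, so
    the squared distance from [s] to [y] is at most 4 times that from [z]. *)
Lemma locally_starshaped_proj (R : realType) (n : nat) (S : set 'cV[R]_n)
    (y : 'cV[R]_n) : locally_starshaped S -> S y ->
  exists2 r : R, 0 < r & forall z s, sqdist z y < r -> Defs.proj S z s ->
    sqdist s y <= sqdist z y - sqdist z s.
Proof.
move=> starS Sy; have [r r0 star] := starS _ Sy.
exists (r / 4) => [|z s zy zs]; first by rewrite divr_gt0.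
apply: (proj_pythagoras zs); apply: star; first by case: zs.
apply: le_lt_trans (sqdist_midpoint s z y) _.
by have := proj_le zs Sy; rewrite (sqdistC y z); lra.
Qed.

(** The gap [sqdist w p] kept on the right is what makes the intermediate
    points approach the iterates, so that both have the same cluster points. *)
Lemma alternating_fejer (R : realType) (n : nat) (S1 S2 : set 'cV[R]_n)
    (y : 'cV[R]_n) :
  locally_starshaped S1 -> locally_starshaped S2 -> (S1 `&` S2) y ->
  exists2 r : R, 0 < r & forall w p x, sqdist w y < r ->
    Defs.proj S2 w p -> Defs.proj S1 p x -> sqdist x y <= sqdist w y - sqdist w p.
Proof.
move=> star1 star2 [Sy1 Sy2].
have [r1 r1_gt0 fejer1] := locally_starshaped_proj star1 Sy1.
have [r2 r2_gt0 fejer2] := locally_starshaped_proj star2 Sy2.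
exists (Num.min r1 r2) => [|w p x]; first by rewrite lt_min r1_gt0.
rewrite lt_min => /andP[wy1 wy2] wp px.
have py := fejer2 _ _ wy2 wp.
have {}wy1 : sqdist p y < r1 by have := sqdist_ge0 w p; lra.
by have := fejer1 _ _ wy1 px; have := sqdist_ge0 p x; lra.
Qed.

(** * Convergence of sequences of vectors *)

(** Bolzano-Weierstrass, in the form used to be combined with monotonicity:
    transposition turns the sequence into row vectors, whose coordinate boxes
    are compact. *)
Lemma bounded_seq_cluster (R : realType) (n : nat) (w : nat -> 'cV[R]_n)
    (M : R) : (forall k i, `|w k i 0| <= M) ->
  exists y, forall e, 0 < e -> forall N, exists2 k, (N <= k)%N & sqdist (w k) y < e.
Proof.
move=> wM.
have K_compact : compact [set v : 'rV[R]_n | forall i, `[- M, M]%classic (v 0 i)].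
  by apply: (@rV_compact _ _ (fun=> `[- M, M]%classic)) => _; exact: segment_compact.
have wK : \forall k \near \oo, forall i, `[- M, M]%classic ((w k)^T 0 i).
  by apply: nearW => k i /=; rewrite mxE in_itv /= -ler_norml.
have [v [_ v_cluster]] := K_compact ((fun k => (w k)^T) @ \oo) _ wK.
exists v^T => e e0 N.
(* coordinates within [d] give a squared distance at most [n * d ^+ 2 < e] *)
pose d := Num.sqrt (e / n.+1%:R).
have d0 : 0 < d by rewrite sqrtr_gt0 divr_gt0.
have [_ [[k /= Nk <-] [_ vk]]] :
    [set (w k)^T | k in [set k | (N <= k)%N]] `&` ball v d !=set0.
  apply: v_cluster; last exact: nbhsx_ballx.
  by exists N => // k /= Nk; exists k.
exists k => //.
have : sqdist (w k) v^T <= \sum_(i < n) (e / n.+1%:R).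
  apply: ler_sum => i _; rewrite !mxE -expr2.
  have -> : e / n.+1%:R = d ^+ 2 by rewrite sqr_sqrtr// divr_ge0// ltW.
  rewrite -[leLHS]real_normK ?num_real// lerXn2r ?nnegrE// ?ltW//.
  by have := vk 0 i; rewrite /ball/= mxE distrC.
move=> /le_lt_trans; apply.
rewrite sumr_const card_ord -[ltLHS]mulr_natr -mulrA gtr_pMr//.
by rewrite mulrC ltr_pdivrMr// mul1r ltr_nat.
Qed.

Lemma sqdist_cvg (R : realType) (n : nat) (w : nat -> 'cV[R]_n) (y : 'cV[R]_n) :
  (forall e, 0 < e -> exists N, forall k, (N <= k)%N -> sqdist (w k) y < e) ->
  w @ \oo --> y.
Proof.
move=> wy; apply/cvg_ballP => e e0.
have [N wN] := wy (e ^+ 2) (exprn_gt0 2 e0).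
exists N => // k /= /wN wk; split=> // i j.
by rewrite ord1 /ball/= distrC; exact: coord_dist_lt.
Qed.

Lemma closed_of_approx (R : realType) (n : nat) (S : set 'cV[R]_n) (y : 'cV[R]_n) :
  closed S -> (forall e, 0 < e -> exists2 s, S s & sqdist s y < e) -> S y.
Proof.
move=> clS Sy; apply: clS => B /nbhs_ballP[e /= e0 eB].
have [s Ss sy] := Sy (e ^+ 2) (exprn_gt0 2 e0).
exists s; split => //; apply: eB; split=> // i j.
by rewrite ord1 /ball/= distrC; exact: coord_dist_lt.
Qed.

(** [r k] is at most [a k - a k.+1], a difference of consecutive terms of a
    convergent sequence. *)
Lemma decrease_vanishes (R : realType) (a r : nat -> R) :
  (forall k, 0 <= a k) -> (forall k, a k.+1 <= a k - r k) ->
  (forall k, 0 <= r k) ->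
  forall e, 0 < e -> exists N, forall k, (N <= k)%N -> r k < e.
Proof.
move=> a0 decr r0 e e0.
have a_cvg : cvgn a.
  apply: nonincreasing_is_cvgn; last by exists 0 => _ [k _ <-].
  by apply/nonincreasing_seqP => k; have := decr k; have := r0 k; lra.
have : (fun k => a k - a k.+1) @ \oo --> (0 : R).
  rewrite -(subrr (limn a)); apply: cvgB => //.
  by have := a_cvg; rewrite -(cvg_shiftS a).
move=> /cvgr0Pnorm_lt /(_ e e0) [N _ aN]; exists N => k /aN /=.
by move=> /ltr_normlW; have := decr k; lra.
Qed.

(** * Alternating projections *)

(** The Fejer inequality is used at [z] to confine the iterates and produce a
    cluster point [l], then at [l] itself: the iterates come arbitrarily close
    to [l], hence within whatever radius [l] has. *)
Lemma alternating_proj_cvg (R : realType) (n : nat) (S1 S2 : set 'cV[R]_n)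
    (z : 'cV[R]_n) :
  closed S1 -> closed S2 -> locally_starshaped S1 -> locally_starshaped S2 ->
  (S1 `&` S2) z ->
  exists2 delta : R, 0 < delta & forall w : nat -> 'cV[R]_n,
    enorm (w 0%N - z) < delta ->
    (forall k, proj_comp S1 S2 (w k) (w k.+1)) ->
    exists2 l, (S1 `&` S2) l & w @ \oo --> l.
Proof.
move=> cl1 cl2 star1 star2 Sz.
have [r r0 fejer_z] := alternating_fejer star1 star2 Sz.
exists (Num.sqrt r) => [|w w0 step]; first by rewrite sqrtr_gt0.
have {}w0 : sqdist (w 0%N) z < r by move: w0; rewrite /enorm ltr_sqrt.
have /choice[p wp] : forall k, exists p,
    Defs.proj S2 (w k) p /\ Defs.proj S1 p (w k.+1).
  by move=> k; case: (step k) => p; exists p.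
have wr k : sqdist (w k) z < r.
  elim: k => // k wk; have [wpk pwk] := wp k.
  by have := fejer_z _ _ _ wk wpk pwk; have := sqdist_ge0 (w k) (p k); lra.
have decr k : sqdist (w k.+1) z <= sqdist (w k) z - sqdist (w k) (p k).
  by have [] := wp k; exact: fejer_z.
have gap := decrease_vanishes (fun k => sqdist_ge0 (w k) z) decr
  (fun k => sqdist_ge0 (w k) (p k)).
have [l lw] : exists l, forall e, 0 < e -> forall N,
    exists2 k, (N <= k)%N & sqdist (w k) l < e.
  apply: (@bounded_seq_cluster _ _ _ (Num.sqrt r + Num.sqrt (sqdist z 0))).
  move=> k i; rewrite -[X in `|X|](subrK (z i 0)).
  apply: le_trans (ler_normD _ _) _; apply: lerD.
    by apply/ltW/coord_dist_lt; rewrite ?sqrtr_gt0// sqr_sqrtr// ltW.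
  have := sqr_coord_le_sqdist z 0 i; rewrite mxE subr0 => zi.
  by rewrite -sqrtr_sqr ler_sqrt// sqdist_ge0.
have Sl : (S1 `&` S2) l.
  split; [apply: (closed_of_approx cl1)|apply: (closed_of_approx cl2)] => e e0.
    (* the starting point [w 0] need not lie in [S1], later iterates do *)
    have [k k1 wk] := lw e e0 1%N.
    exists (w k) => //; case: k k1 {wk} => // k _.
    by have [_ []] := wp k.
  have e4 : 0 < e / 4 by rewrite divr_gt0.
  have [N wpN] := gap _ e4; have [k Nk wk] := lw _ e4 N.
  exists (p k); first by have [[]] := wp k.
  apply: le_lt_trans (sqdist_midpoint _ (w k) _) _.
  by have := wpN k Nk; rewrite (sqdistC (p k)); lra.
have [rl rl0 fejer_l] := alternating_fejer star1 star2 Sl.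
exists l => //; apply: sqdist_cvg => e e0.
have [N _ wN] : exists2 N, (0 <= N)%N & sqdist (w N) l < Num.min e rl.
  by apply: lw; rewrite lt_min e0.
suff wNj j : sqdist (w (N + j)%N) l < Num.min e rl.
  by exists N => k /subnKC <-; have := wNj (k - N)%N; rewrite lt_min => /andP[].
elim: j => [|j IHj]; first by rewrite addn0.
rewrite addnS; apply: le_lt_trans (IHj).
have [wpj pwj] := wp (N + j)%N.
have := fejer_l _ _ _ _ wpj pwj; move: IHj; rewrite lt_min => /andP[_ wl] /(_ wl).
by have := sqdist_ge0 (w (N + j)%N) (p (N + j)%N); lra.
Qed.

(** * The affine constraint *)

Lemma continuous_coord_sum (R : realType) (n : nat) (a : 'I_n -> R) :
  continuous (fun w : 'cV[R]_n => \sum_i a i * w i 0).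
Proof.
apply: (continuous_big (U := R)) => [|i _ w]; first exact: add_continuous.
exact: (cvgM (cvg_cst (a i)) (@coord_continuous R n 1 i 0 w)).
Qed.

Lemma closed_C1 (R : realType) (m n : nat) (A B : 'M[R]_(m, n))
    (c : 'cV[R]_m) : closed (C1 A B c).
Proof.
have -> : C1 A B c = \bigcap_(i in setT)
    (fun w : 'cV[R]_(n + n) => \sum_j Tmx A B i j * w j 0) @^-1`
      [set x | x = (Num.sqrt 2 *: c) i 0].
  apply/seteqP; split=> [w <- i _ /=|w Tw]; first by rewrite mxE.
  by apply/matrixP => i j; rewrite ord1 -(Tw i I) mxE.
apply: closed_bigI => i _; apply: preimage_closed; last exact: closed_eq.
by move=> w _; exact: continuous_coord_sum.
Qed.

Lemma locally_starshaped_C1 (R : realType) (m n : nat) (A B : 'M[R]_(m, n))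
    (c : 'cV[R]_m) : locally_starshaped (C1 A B c).
Proof.
move=> y Ty; exists 1 => // s Ts _ t _; rewrite /C1 /=.
by rewrite mulmxDr -scalemxAr mulmxBr Ts Ty subrr scaler0 addr0.
Qed.

(** * The complementarity constraint *)

(** A vanishing sum of nonnegative products vanishes term by term, so
    orthogonality is a condition on each pair of coordinates. *)
Lemma C2_coordP (R : realType) (n : nat) (w : 'cV[R]_(n + n)) :
  C2 w <-> (forall i, 0 <= w i 0) /\
    forall i, w (lshift n i) 0 * w (rshift n i) 0 = 0.
Proof.
split=> [[u0 v0 uv]|[w0 uv]].
  split=> i; first by case: (split_ordP i) => j ->;
    [have := u0 j|have := v0 j]; rewrite mxE.
  have := uv => /eqP; rewrite psumr_eq0 => [/allP /(_ i)|j _]; last exact: mulr_ge0.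
  by rewrite mem_index_enum => /(_ isT) /eqP; rewrite !mxE.
by split=> [i|i|]; rewrite ?mxE// /dotv big1// => i _; rewrite !mxE.
Qed.

Lemma closed_C2 (R : realType) (n : nat) : closed (@C2 R n).
Proof.
have -> : @C2 R n =
    \bigcap_(i in setT) ((fun w : 'cV[R]_(n + n) => w i 0) @^-1` [set x | 0 <= x])
    `&` \bigcap_(i in setT) ((fun w : 'cV[R]_(n + n) =>
      w (lshift n i) 0 * w (rshift n i) 0) @^-1` [set x | x = 0]).
  apply/seteqP; split=> w.
    by move=> /C2_coordP[w0 uv]; split=> i _; [exact: w0|exact: uv].
  by move=> [w0 uv]; apply/C2_coordP; split=> i; [exact: w0|exact: uv].
apply: closedI; apply: closed_bigI => i _; apply: preimage_closed.
- by move=> w _; exact: coord_continuous.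
- exact: closed_ge.
- move=> w _; exact: (cvgM
    (@coord_continuous R (n + n) 1 (lshift n i) 0 w)
    (@coord_continuous R (n + n) 1 (rshift n i) 0 w)).
- exact: closed_eq.
Qed.

(** A point [s] closer to [y] than the least positive coordinate of [y] is
    nonzero wherever [y] is; complementarity of [s] then forces [s] to vanish
    opposite to each nonzero coordinate of [y], so the cross terms along the
    segment vanish too. *)
Lemma locally_starshaped_C2 (R : realType) (n : nat) :
  locally_starshaped (@C2 R n).
Proof.
move=> y /C2_coordP[y0 yuv].
(* the default 1 serves when [y = 0], where any radius works *)
pose d := \big[Num.min/1]_(i | 0 < y i 0) y i 0.
have d0 : 0 < d by exact: lt_bigmin.
exists (d ^+ 2) => [|s /C2_coordP[s0 suv] sy t /andP[t0 t1]]; first exact: exprn_gt0.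
have s_pos i : y i 0 != 0 -> s i 0 != 0.
  move=> yi; have {}yi : 0 < y i 0 by rewrite lt_def yi y0.
  have dy : d <= y i 0 by exact: bigmin_le_cond.
  have := coord_dist_lt i d0 sy; rewrite distrC => /ltr_normlW syi.
  by rewrite gt_eqF//; lra.
apply/C2_coordP; split=> i; rewrite !mxE; first by have := s0 i; have := y0 i; nra.
set j := lshift n i; set k := rshift n i.
have cross a b : s a 0 * s b 0 = 0 -> s a 0 * y b 0 = 0.
  have [->|/s_pos sb] := eqVneq (y b 0) 0; first by rewrite mulr0.
  by move/eqP; rewrite mulf_eq0 (negbTE sb) orbF => /eqP ->; rewrite mul0r.
have sjk := suv i; rewrite -/j -/k in sjk.
have skj : s k 0 * s j 0 = 0 by rewrite mulrC.
have yjk := yuv i; rewrite -/j -/k in yjk.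
have := cross _ _ sjk; have := cross _ _ skj.
have -> : (s j 0 + t * (y j 0 - s j 0)) * (s k 0 + t * (y k 0 - s k 0)) =
  (1 - t) ^+ 2 * (s j 0 * s k 0) + t ^+ 2 * (y j 0 * y k 0)
  + t * (1 - t) * (s j 0 * y k 0 + s k 0 * y j 0) by ring.
by rewrite sjk yjk => -> ->; ring.
Qed.

Theorem theorem3p1 (R : realType) (m n : nat) (A B : 'M[R]_(m, n))
    (c : 'cV[R]_m) (wstar : 'cV[R]_(n + n))
    (hwstar : (C1 A B c `&` C2) wstar) :
  exists2 delta : R, 0 < delta &
    forall w0 : 'cV[R]_(n + n), enorm (w0 - wstar) < delta ->
    forall w : nat -> 'cV[R]_(n + n), w 0%N = w0 ->
      (forall k : nat, proj_comp (C1 A B c) C2 (w k) (w k.+1)) ->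
      exists2 l : 'cV[R]_(n + n), (C1 A B c `&` C2) l & w @ \oo --> l.
Proof.
have [delta delta0 cvg] := alternating_proj_cvg (@closed_C1 _ _ _ A B c)
  (@closed_C2 R n) (@locally_starshaped_C1 _ _ _ A B c)
  (@locally_starshaped_C2 R n) hwstar.
by exists delta => // w0 w0star w w_0 step; apply: cvg; rewrite ?w_0.
Qed.
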